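(* Let $R$ be a ring. A Tate $R$-module $M$ has the following properties: (a) $M$ is complete and Hausdorff; (b) lattices in $M$ form a base of neighborhoods of $0$; (c) the functor from discrete $R$-modules to abelian groups sending $N$ to the group $\operatorname{Hom}(M,N)$ of continuous homomorphisms $M\to N$ is exact. Conversely, if a topological $R$-module $M$ has a countable base of neighborhoods of $0$ and satisfies (a), (b), (c), then $M$ is a Tate $R$-module.
   Context: A Tate $R$-module is a topological direct summand of $P\oplus Q^*$ with $P$ a discrete projective left $R$-module, $Q$ a discrete projective right $R$-module and $Q^*=\operatorname{Hom}_R(Q,R)$ with the topology of pointwise convergence. A lattice in a topological $R$-module $M$ is an open submodule $L$ such that $L/U$ is finitely generated for every open submodule $U\subset L$. *)

(* Defs.v *)
(* Rings are arbitrary (possibly non-commutative, possibly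
   zero) pzRingTypes; R carries the discrete topology.
   Left R-modules are [lmodType R]; right R-modules are left modules over the
   converse ring [R^c], i.e. [Q : lmodType R^c], where [(a : R^c) *: q]
   stands for q.a. *)
From mathcomp Require Import all_boot all_algebra.
Set Implicit Arguments. Unset Strict Implicit. Unset Printing Implicit Defensive.
Import GRing.Theory.
Local Open Scope ring_scope.

Section Defs.
Variable R : pzRingType.

Definition is_linear (S : pzRingType) (A B : lmodType S) (f : A -> B) :=
  forall (a : S) (x y : A), f (a *: x + y) = a *: f x + f y.

Definition projective (S : pzRingType) (P : lmodType S) :=
  forall (A B : lmodType S) (g : A -> B) (f : P -> B),
    is_linear g -> (forall b, exists a, g a = b) -> is_linear f ->
    exists h : P -> A, is_linear h /\ forall x, g (h x) = f x.

Section Top.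
Variable M : lmodType R.
Variable op : (M -> Prop) -> Prop.

Definition is_topology :=
  [/\ op (fun _ => True),
      (forall F : (M -> Prop) -> Prop, (forall U, F U -> op U) ->
          op (fun x => exists2 U, F U & U x)) &
      (forall U V, op U -> op V -> op (fun x => U x /\ V x))].

Definition nbhd (x : M) (U : M -> Prop) :=
  exists V, [/\ op V, V x & forall y, V y -> U y].

(* M is a topological R-module (R discrete) *)
Definition is_tmod :=
  [/\ is_topology,
      (forall x y U, op U -> U (x + y) ->
          exists V W, [/\ op V, V x, op W, W y &
                        forall v w, V v -> W w -> U (v + w)]),
      (forall x U, op U -> U (- x) ->
          exists2 V, op V /\ V x & forall v, V v -> U (- v)) &
      (forall (a : R) x U, op U -> U (a *: x) ->
          exists2 V, op V /\ V x & forall v, V v -> U (a *: v))].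

Definition hausdorff :=
  forall x y : M, x <> y ->
    exists U V, [/\ op U, op V, U x, V y & forall z, U z -> V z -> False].

Definition is_filter (F : (M -> Prop) -> Prop) :=
  [/\ F (fun _ => True),
      (forall A B, F A -> F B -> F (fun x => A x /\ B x)),
      (forall A B : M -> Prop, F A -> (forall x, A x -> B x) -> F B) &
      ~ F (fun _ => False)].

Definition cauchy (F : (M -> Prop) -> Prop) :=
  forall U, nbhd 0 U -> exists2 A, F A & forall x y, A x -> A y -> U (x - y).

Definition converges_to (F : (M -> Prop) -> Prop) (l : M) :=
  forall U, nbhd l U -> F U.

Definition complete :=
  forall F, is_filter F -> cauchy F -> exists l, converges_to F l.

Definition is_submod (S : M -> Prop) :=
  [/\ S 0, (forall x y, S x -> S y -> S (x + y)) &
      (forall (a : R) x, S x -> S (a *: x))].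

(* the quotient L/U is a finitely generated R-module (U a submodule of L) *)
Definition fg_quotient (L U : M -> Prop) :=
  exists n (g : 'I_n -> M), (forall i, L (g i)) /\
    forall x, L x -> exists c : 'I_n -> R, U (x - \sum_(i < n) c i *: g i).

Definition lattice (L : M -> Prop) :=
  [/\ is_submod L, op L &
      forall U, is_submod U -> op U -> (forall x, U x -> L x) ->
        fg_quotient L U].

Definition lattices_base :=
  forall U, nbhd 0 U -> exists2 L, lattice L & forall x, L x -> U x.

Definition countable_base_at0 :=
  exists B : nat -> M -> Prop, (forall n, nbhd 0 (B n)) /\
    forall U, nbhd 0 U -> exists n, forall x, B n x -> U x.

(* continuous homomorphisms M -> N, N discrete *)
Definition cont_hom (N : lmodType R) (h : M -> N) :=
  is_linear h /\ forall S : N -> Prop, op (fun x => S (h x)).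

Definition hom_exact :=
  forall (N1 N2 N3 : lmodType R) (f : N1 -> N2) (g : N2 -> N3),
    is_linear f -> is_linear g -> injective f ->
    (forall z, exists y, g y = z) ->
    (forall y, g y = 0 <-> exists x, y = f x) ->
    [/\ (forall h h' : M -> N1, cont_hom h -> cont_hom h' ->
           (forall x, f (h x) = f (h' x)) -> forall x, h x = h' x),
        (forall h2 : M -> N2, cont_hom h2 ->
           ((forall x, g (h2 x) = 0) <->
            exists2 h1 : M -> N1, cont_hom h1 & forall x, h2 x = f (h1 x))) &
        (forall h3 : M -> N3, cont_hom h3 ->
           exists2 h2 : M -> N2, cont_hom h2 & forall x, h3 x = g (h2 x))].

End Top.

(* Q^* = Hom_R(Q, R) for a right module Q: maps phi with phi(q a + q') =
   phi(q) a + phi(q'); left R-module via (r phi)(q) = r phi(q).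
   Elements of P (+) Q^* are pairs u in P * (Q -> R) with u.2 in Q^*. *)
Definition rlinear (Q : lmodType R^c) (phi : Q -> R) :=
  forall (a : R) (q q' : Q), phi ((a : R^c) *: q + q') = phi q * a + phi q'.

Section Tate.
Variables (M : lmodType R) (op : (M -> Prop) -> Prop).

(* M is a topological direct summand (= retract in the category of
   topological R-modules) of P (+) Q^*, with P discrete and Q^* carrying
   the topology of pointwise convergence (R discrete).  A base of
   neighbourhoods of u in P (+) Q^* is given by the sets
   { v | v.1 = u.1 and v.2 q = u.2 q for q in qs }, qs a finite list. *)
Definition summand_of (P : lmodType R) (Q : lmodType R^c) :=
  exists (i : M -> P * (Q -> R)) (p : P * (Q -> R) -> M),
  [/\
      (forall x, rlinear (i x).2) /\
      (forall (a : R) x y,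
          (i (a *: x + y)).1 = a *: (i x).1 + (i y).1 /\
          forall q, (i (a *: x + y)).2 q = a * (i x).2 q + (i y).2 q),
      (forall x (qs : seq Q), exists2 U, op U /\ U x &
          forall y, U y -> (i y).1 = (i x).1 /\
                           forall q, q \in qs -> (i y).2 q = (i x).2 q),
      (forall (a : R) u v, rlinear u.2 -> rlinear v.2 ->
          p (a *: u.1 + v.1, fun q => a * u.2 q + v.2 q) = a *: p u + p v),
      (forall u W, rlinear u.2 -> op W -> W (p u) ->
          exists qs : seq Q, forall v, rlinear v.2 -> v.1 = u.1 ->
             (forall q, q \in qs -> v.2 q = u.2 q) -> W (p v)) &
      (forall x, p (i x) = x)].

Definition tate :=
  exists (P : lmodType R) (Q : lmodType R^c),
    [/\ projective P, projective Q & summand_of P Q].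

End Tate.
End Defs.

(* Main.v *)
(** If Q is projective, then Q^* is a topological direct summand of some R^B, so a
    Tate module is a topological retract of P (+) R^B with P discrete projective.
    Completeness, separation and exactness of Hom(M, -) pass to the retract, and the
    images of the submodules of R^B given by the vanishing of finitely many
    coordinates are lattices.

    Conversely, take a decreasing base of lattices L_0, L_1, ... and let P be the free
    module on the elements of M.  Exactness lifts M -> M/L_0 to a continuous
    c : M -> P; the residual t_0 = id - pi c takes values in L_0.  Since L_n/L_(n+1) is
    finitely generated, exactness lifts t_n mod L_(n+1) to a continuous map
    M -> R^(r_n), and subtracting the corresponding combination of generators
    g_(n,i) in L_n from t_n gives t_(n+1) with values in L_(n+1).  Hence
    x = pi (c x) + sum_(n,i) k_(n,i)(x) g_(n,i), a convergent series which exhibits M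
    as a retract of P (+) R^(nat * nat). *)
Require Import Defs.
From HB Require Import structures.
From mathcomp Require Import all_boot all_algebra finmap boolp.
From mathcomp.multinomials Require Import monalg.

Set Implicit Arguments. Unset Strict Implicit. Unset Printing Implicit Defensive.
Import GRing.Theory.
Local Open Scope ring_scope.

(** * Linear maps, submodules and quotients *)

Section IsLinear.
Variables (S : pzRingType) (A B : lmodType S) (f : A -> B).
Hypothesis lin_f : is_linear f.

Lemma is_linear0 : f 0 = 0.
Proof.
have := lin_f 1 0 0; rewrite !scale1r addr0 => /eqP.
by rewrite -subr_eq0 opprD addrA subrr add0r oppr_eq0 => /eqP.
Qed.

Lemma is_linearD x y : f (x + y) = f x + f y.
Proof. by rewrite -[x in LHS]scale1r lin_f scale1r. Qed.

Lemma is_linearZ a x : f (a *: x) = a *: f x.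
Proof. by rewrite -[_ *: x in LHS]addr0 lin_f is_linear0 addr0. Qed.

Lemma is_linearN x : f (- x) = - f x.
Proof. by rewrite -scaleN1r is_linearZ scaleN1r. Qed.

Lemma is_linearB x y : f (x - y) = f x - f y.
Proof. by rewrite is_linearD is_linearN. Qed.

Lemma is_linear_sum I (r : seq I) (P : pred I) (F : I -> A) :
  f (\sum_(i <- r | P i) F i) = \sum_(i <- r | P i) f (F i).
Proof. exact: (big_morph f is_linearD is_linear0). Qed.

End IsLinear.

Section Submodule.
Variables (S : pzRingType) (A : lmodType S) (K : A -> Prop).
Hypothesis subK : is_submod K.

Lemma submod0 : K 0. Proof. by case: subK. Qed.

Lemma submodD x y : K x -> K y -> K (x + y).
Proof. by case: subK => _ + _; apply. Qed.

Lemma submodZ a x : K x -> K (a *: x).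
Proof. by case: subK => _ _; apply. Qed.

Lemma submodN x : K x -> K (- x).
Proof. by rewrite -scaleN1r; apply: submodZ. Qed.

Lemma submodB x y : K x -> K y -> K (x - y).
Proof. by move=> Kx Ky; apply: submodD => //; apply: submodN. Qed.

Lemma submodBC x y : K (x - y) -> K (y - x).
Proof. by move/submodN; rewrite opprB. Qed.

Lemma submod_trans y x z : K (x - y) -> K (y - z) -> K (x - z).
Proof. by move=> Kxy Kyz; rewrite -(subrKA y); apply: submodD. Qed.

Lemma submod_sum I (r : seq I) (P : pred I) (F : I -> A) :
  (forall i, P i -> K (F i)) -> K (\sum_(i <- r | P i) F i).
Proof. by move=> KF; apply: big_ind => //; [apply: submod0|apply: submodD]. Qed.

(** The proof of [is_submod K] is a parameter so that the closure instance, and with it the module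
    structure on [submod_of], can be keyed on it. *)
Definition submod_mem of is_submod K : {pred A} := fun x => `[< K x >].

Lemma submod_memP x : reflect (K x) (x \in submod_mem subK).
Proof. exact: asboolP. Qed.

Lemma submod_mem_closed : submod_closed (submod_mem subK).
Proof.
split; first exact/submod_memP/submod0.
move=> a x y /submod_memP Kx /submod_memP Ky; apply/submod_memP.
by apply: submodD => //; apply: submodZ.
Qed.

HB.instance Definition _ :=
  GRing.isSubmodClosed.Build S A (submod_mem subK) submod_mem_closed.

Record submod_of := SubmodOf { submod_val : A; _ : submod_val \in submod_mem subK }.

HB.instance Definition _ := [isSub for submod_val].
HB.instance Definition _ := [Choice of submod_of by <:].
HB.instance Definition _ := [SubChoice_isSubLmodule of submod_of by <:].

Lemma submod_val_linear : is_linear submod_val.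
Proof. by move=> a x y; rewrite -[LHS]/(\val _) linearP. Qed.

(** Up to extensional equality the predicate depends only on the coset of [x], so [choose] returns
    one representative per coset. The quotient can then be the subtype of elements fixed by this
    choice. *)
Definition coset_rep of is_submod K := fun x : A => choose (fun y => `[< K (y - x) >]) x.

Local Notation rep := (coset_rep subK).

Lemma coset_repP x : K (rep x - x).
Proof.
apply/asboolP; apply: (@chooseP A (fun y => `[< K (y - x) >])).
by apply/asboolP; rewrite subrr; apply: submod0.
Qed.

Lemma eq_coset_rep x y : K (x - y) -> rep x = rep y.
Proof.
move=> Kxy; rewrite /coset_rep.
rewrite (@eq_choose _ _ (fun z => `[< K (z - y) >])); last first.
  move=> z; apply/asboolP/asboolP => Kz.
    exact: submod_trans Kz Kxy.
  by apply: submod_trans Kz _; apply: submodBC.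
by apply: choose_id; apply/asboolP => //; rewrite subrr; apply: submod0.
Qed.

Lemma coset_rep_id x : rep (rep x) = rep x.
Proof. exact/eq_coset_rep/coset_repP. Qed.

Record quot_of := QuotOf { quot_val : A; _ : rep quot_val == quot_val }.

HB.instance Definition _ := [isSub for quot_val].
HB.instance Definition _ := [Choice of quot_of by <:].

Definition quot_proj x : quot_of := @QuotOf (rep x) (introT eqP (coset_rep_id x)).

Lemma quot_valK u : quot_proj (quot_val u) = u.
Proof. by apply: val_inj; apply/eqP; case: u. Qed.

Lemma quot_projE x y : quot_proj x = quot_proj y <-> K (x - y).
Proof.
split=> [/(congr1 quot_val) /= exy|Kxy]; last by apply: val_inj; apply: eq_coset_rep.
apply: (@submod_trans (rep x)); first exact/submodBC/coset_repP.
by rewrite exy; apply: coset_repP.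
Qed.

Definition quot_add u v := quot_proj (quot_val u + quot_val v).
Definition quot_opp u := quot_proj (- quot_val u).
Definition quot_scale a u := quot_proj (a *: quot_val u).

Lemma quot_projD x y : quot_add (quot_proj x) (quot_proj y) = quot_proj (x + y).
Proof. by apply/quot_projE; rewrite opprD addrACA; apply: submodD; apply: coset_repP. Qed.

Lemma quot_projN x : quot_opp (quot_proj x) = quot_proj (- x).
Proof. by apply/quot_projE; rewrite -opprD; apply/submodN/coset_repP. Qed.

Lemma quot_projZ a x : quot_scale a (quot_proj x) = quot_proj (a *: x).
Proof. by apply/quot_projE; rewrite -scalerBr; apply/submodZ/coset_repP. Qed.

Lemma quot_ind (T : quot_of -> Prop) : (forall x, T (quot_proj x)) -> forall u, T u.
Proof. by move=> Tp u; rewrite -(quot_valK u). Qed.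

Lemma quot_addA : associative quot_add.
Proof.
by elim/quot_ind=> x; elim/quot_ind=> y; elim/quot_ind=> z; rewrite !quot_projD addrA.
Qed.

Lemma quot_addC : commutative quot_add.
Proof. by elim/quot_ind=> x; elim/quot_ind=> y; rewrite !quot_projD addrC. Qed.

Lemma quot_add0 : left_id (quot_proj 0) quot_add.
Proof. by elim/quot_ind=> x; rewrite quot_projD add0r. Qed.

Lemma quot_addN : left_inverse (quot_proj 0) quot_opp quot_add.
Proof. by elim/quot_ind=> x; rewrite quot_projN quot_projD addNr. Qed.

HB.instance Definition _ :=
  GRing.isZmodule.Build quot_of quot_addA quot_addC quot_add0 quot_addN.

Lemma quot_proj_add x y : quot_proj (x + y) = quot_proj x + quot_proj y.
Proof. by rewrite -quot_projD. Qed.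

Lemma quot_scaleA a b u : quot_scale a (quot_scale b u) = quot_scale (a * b) u.
Proof. by elim/quot_ind: u => x; rewrite !quot_projZ scalerA. Qed.

Lemma quot_scale1 : left_id 1 quot_scale.
Proof. by elim/quot_ind=> x; rewrite quot_projZ scale1r. Qed.

Lemma quot_scaleDr : right_distributive quot_scale +%R.
Proof.
move=> a; elim/quot_ind=> x; elim/quot_ind=> y.
by rewrite -quot_proj_add !quot_projZ -quot_proj_add scalerDr.
Qed.

Lemma quot_scaleDl u : {morph quot_scale^~ u : a b / a + b}.
Proof.
move=> a b; elim/quot_ind: u => x.
by rewrite !quot_projZ -quot_proj_add scalerDl.
Qed.

HB.instance Definition _ := GRing.Zmodule_isLmodule.Build S quot_of
  quot_scaleA quot_scale1 quot_scaleDr quot_scaleDl.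

Lemma quot_proj_linear : is_linear quot_proj.
Proof.
by move=> a x y; rewrite quot_proj_add -quot_projZ.
Qed.

End Submodule.

(** * Free modules *)

Section Free.
Variables (S : pzRingType) (B : choiceType).

Definition free_mod := {malg S[B]}.

HB.instance Definition _ := GRing.Zmodule.on free_mod.
Implicit Types (a b : S) (g h : free_mod).

Definition free_scale a g : free_mod := [malg k in msupp g => a * g@_k].

Lemma free_scaleE a g k : (free_scale a g)@_k = a * g@_k.
Proof. by rewrite mcoeffE; case: msuppP; rewrite ?mulr0. Qed.

Lemma free_scaleA a b g : free_scale a (free_scale b g) = free_scale (a * b) g.
Proof. by apply/malgP=> k; rewrite !free_scaleE mulrA. Qed.

Lemma free_scale1 : left_id 1 free_scale.
Proof. by move=> g; apply/malgP=> k; rewrite free_scaleE mul1r. Qed.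

Lemma free_scaleDr : right_distributive free_scale +%R.
Proof. by move=> a g h; apply/malgP=> k; rewrite mcoeffD !free_scaleE mcoeffD mulrDr. Qed.

Lemma free_scaleDl g : {morph free_scale^~ g : a b / a + b}.
Proof. by move=> a b; apply/malgP=> k; rewrite mcoeffD !free_scaleE mulrDl. Qed.

HB.instance Definition _ := GRing.Zmodule_isLmodule.Build S free_mod
  free_scaleA free_scale1 free_scaleDr free_scaleDl.

Lemma free_coefP a g h k : (a *: g + h)@_k = a * g@_k + h@_k.
Proof. by rewrite mcoeffD free_scaleE. Qed.

Definition free_basis (k : B) : free_mod := << 1 *g k >>.

Section Extension.
Variables (A : lmodType S) (f : B -> A).

Definition free_ext g : A := \sum_(k <- msupp g) g@_k *: f k.

(** Enlarging the index set adds only zero terms; this lets elements with different supports be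
    summed over one common finite set. *)
Lemma free_extE (D : {fset B}) g : (msupp g `<=` D)%fset ->
  free_ext g = \sum_(k <- D) g@_k *: f k.
Proof.
move=> gD; rewrite /free_ext (big_fset_incl _ gD) // => k _ /mcoeff_outdom ->.
by rewrite scale0r.
Qed.

Lemma free_ext_linear : is_linear free_ext.
Proof.
move=> a g h; pose D := (msupp g `|` msupp h `|` msupp (a *: g + h)%R)%fset.
have gD : (msupp g `<=` D)%fset by rewrite /D -fsetUA fsubsetUl.
have hD : (msupp h `<=` D)%fset by rewrite /D fsetUAC fsubsetUr.
have sD : (msupp (a *: g + h)%R `<=` D)%fset by rewrite /D fsubsetUr.
rewrite (free_extE gD) (free_extE hD) (free_extE sD) scaler_sumr -big_split /=.
by apply: eq_bigr => k _; rewrite free_coefP scalerDl scalerA.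
Qed.

Lemma free_ext_basis k : free_ext (free_basis k) = f k.
Proof. by rewrite (free_extE msuppU_le) big_seq_fset1 mcoeffUU scale1r. Qed.

End Extension.

Lemma free_mod_ext (A : lmodType S) (f f' : free_mod -> A) :
  is_linear f -> is_linear f' ->
  (forall k, f (free_basis k) = f' (free_basis k)) -> f =1 f'.
Proof.
move=> lf lf' eqf g.
have -> : g = \sum_(k <- msupp g) g@_k *: free_basis k.
  rewrite {1}[g]monalgE; apply: eq_bigr => k _; apply/malgP => j.
  by rewrite free_scaleE !mcoeffU; case: eqP; rewrite ?mulr1 ?mulr0.
by rewrite !is_linear_sum //; apply: eq_bigr => k _; rewrite !is_linearZ // eqf.
Qed.

Lemma free_mod_projective : projective free_mod.
Proof.
move=> A A' g f lg surj_g lf.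
have [s gs] := choice (fun k => surj_g (f (free_basis k))).
exists (free_ext s); split; first exact: free_ext_linear.
apply: free_mod_ext => // [a x y|k]; last by rewrite free_ext_basis gs.
by rewrite free_ext_linear lg.
Qed.

End Free.

(** * Topological modules and retracts of P (+) R^B *)

Section TopologicalModule.
Variables (R : pzRingType) (M : lmodType R) (op : (M -> Prop) -> Prop).
Hypothesis tmodM : is_tmod op.

Lemma nbhdT x : nbhd op x (fun=> True).
Proof. by case: tmodM => -[opT _ _] _ _ _; exists (fun=> True). Qed.

Lemma nbhdS x (U V : M -> Prop) : (forall y, U y -> V y) -> nbhd op x U -> nbhd op x V.
Proof. by move=> UV [W [oW Wx WU]]; exists W; split=> // y /WU /UV. Qed.

Lemma nbhdI x U V : nbhd op x U -> nbhd op x V -> nbhd op x (fun y => U y /\ V y).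
Proof.
case: tmodM => -[_ _ opI] _ _ _ [U' [oU U'x UU]] [V' [oV V'x VV]].
by exists (fun y => U' y /\ V' y); split=> [|//|y [/UU ? /VV]//]; apply: opI.
Qed.

Lemma nbhd_all (I : eqType) (s : seq I) x (U : I -> M -> Prop) :
  (forall i, nbhd op x (U i)) -> nbhd op x (fun y => forall i, i \in s -> U i y).
Proof.
move=> nU; elim: s => [|i s IHs]; first by apply: nbhdS (nbhdT x).
apply: nbhdS (nbhdI (nU i) IHs) => y [Ui Us] j.
by rewrite inE => /predU1P[->//|/Us].
Qed.

Lemma open_nbhd x U : op U -> U x -> nbhd op x U.
Proof. by exists U. Qed.

Lemma nbhd_open U : (forall x, U x -> nbhd op x U) -> op U.
Proof.
case: tmodM => -[_ opU _] _ _ _ nU.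
have := opU (fun V => op V /\ forall y, V y -> U y) (fun V => @proj1 _ _).
congr op; apply/funext => x; apply/propext; split=> [[V [_ VU] /VU]//|/nU].
by case=> V [oV Vx VU]; exists V.
Qed.

(** Translations are continuous: use continuity of addition at [x + 0], respectively at [- x + x],
    and fix the first summand. *)
Lemma nbhd_shift x U : nbhd op x U <-> nbhd op 0 (fun y => U (x + y)).
Proof.
case: tmodM => _ opD _ _; split=> -[V [oV Vx VU]].
  rewrite -[x]addr0 in Vx; case: (opD _ _ _ oV Vx) => V1 [V2 [_ V1x oV2 V20 V12]].
  by exists V2; split=> // y V2y; apply/VU/V12.
rewrite -[0](addNr x) in Vx; case: (opD _ _ _ oV Vx) => V1 [V2 [_ V1x oV2 V20 V12]].
by exists V2; split=> // y V2y; rewrite -[y](addKr (- x)) opprK; apply/VU/V12.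
Qed.

Lemma open_submod U : is_submod U -> nbhd op 0 U -> op U.
Proof.
move=> subU nU; apply: nbhd_open => x Ux; apply/nbhd_shift.
by apply: nbhdS nU => y; apply: submodD.
Qed.

(** If [h] vanishes near 0, it is constant near every point by linearity, so all its preimages are
    open. *)
Lemma cont_homP (N : lmodType R) (h : M -> N) :
  cont_hom op h <-> is_linear h /\ nbhd op 0 (fun x => h x = 0).
Proof.
split=> -[lh ch]; split=> //.
  by apply: (open_nbhd (ch (fun z => z = 0))); apply: is_linear0.
move=> S; apply: nbhd_open => x Sx; apply/nbhd_shift; apply: nbhdS ch => y hy.
by rewrite is_linearD // hy addr0.
Qed.

(* Exactness of Hom(M, -) on 0 -> K -> N -> N/K -> 0. *)
Lemma hom_exact_lift (N : lmodType R) (K : N -> Prop) (h : M -> N) :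
  hom_exact op -> is_submod K ->
  (forall a x y, K (h (a *: x + y) - (a *: h x + h y))) ->
  nbhd op 0 (fun x => K (h x)) ->
  exists2 k, cont_hom op k & forall x, K (k x - h x).
Proof.
move=> exM subK lh ch.
have [|||||_ _ lift] := exM _ _ _ (@submod_val _ _ _ subK) (quot_proj subK).
- exact: submod_val_linear.
- exact: quot_proj_linear.
- exact: val_inj.
- by move=> z; exists (quot_val z); apply: quot_valK.
- move=> y; rewrite -(is_linear0 (@quot_proj_linear _ _ _ subK)) quot_projE subr0.
  split=> [Ky|[[x /= /submod_memP Kx] ->]//].
  by exists (SubmodOf (introT (submod_memP subK y) Ky)).
(* [h] itself is linear and continuous only modulo [K]; its composite with the projection is a
   genuine continuous homomorphism, to which exactness applies. *)
have chq : cont_hom op (fun x => quot_proj subK (h x)).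
  apply/cont_homP; split=> [a x y|].
    by rewrite -quot_proj_linear; apply/quot_projE.
  apply: nbhdS ch => x Kx.
  by rewrite -(is_linear0 (@quot_proj_linear _ _ _ subK)); apply/quot_projE; rewrite subr0.
have [k ck hk] := lift _ chq; exists k => // x.
by apply: submodBC => //; apply/quot_projE/hk.
Qed.

(* M is a topological direct summand of P (+) R^B, P discrete, R^B with the
   product topology; continuity of p is only required at 0. *)
Record retract (P : lmodType R) (B : eqType)
    (c : M -> P) (e : M -> B -> R) (p : P -> (B -> R) -> M) : Prop := Retract {
  retract_fst : cont_hom op c;
  retract_snd : forall b, cont_hom op (fun x => e x b : R^o);
  retract_linear : forall a u v f g,
    p (a *: u + v) (fun b => a * f b + g b) = a *: p u f + p v g;
  retract_cont : forall U, nbhd op 0 U ->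
    exists s : seq B, forall f, (forall b, b \in s -> f b = 0) -> U (p 0 f);
  retractK : forall x, p (c x) (e x) = x }.

(** * Completeness, separation, lattices and exactness for a retract *)

Section RetractTheory.
Variables (P : lmodType R) (B : eqType).
Variables (c : M -> P) (e : M -> B -> R) (p : P -> (B -> R) -> M).
Hypothesis retM : retract c e p.

Lemma retractD u v f g : p (u + v) (fun b => f b + g b) = p u f + p v g.
Proof.
rewrite -[in RHS](scale1r (p u f)) -(retract_linear retM) scale1r; congr p.
by apply/funext => b; rewrite mul1r.
Qed.

Lemma retract0 : p 0 (fun=> 0) = 0.
Proof.
apply: (addrI (p 0 (fun=> 0))); rewrite addr0 -retractD addr0; congr p.
by apply/funext => b; rewrite addr0.
Qed.

Lemma retractZ a u f : p (a *: u) (fun b => a * f b) = a *: p u f.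
Proof.
rewrite -[RHS]addr0 -retract0 -(retract_linear retM) addr0; congr p.
by apply/funext => b; rewrite addr0.
Qed.

(** This transports the continuity at 0 given by [retract_cont] to arbitrary points. *)
Lemma retractB u f g : p u f = p u g + p 0 (fun b => f b - g b).
Proof. by rewrite -retractD addr0; congr p; apply/funext => b; rewrite addrC subrK. Qed.

Definition delta (j b : B) : R := (b == j)%:R.

(** The sum truncates [f] to [t]. Its difference from [f] vanishes on [t], so [retract_cont] can
    make the image of that difference small. *)
Lemma sum_delta (t : seq B) (f : B -> R) b : uniq t ->
  \sum_(j <- t) f j * delta j b = if b \in t then f b else 0.
Proof.
rewrite /delta; elim: t => [|j t IHt]; first by rewrite big_nil.
rewrite inE big_cons /= => /andP[jt /IHt ->].
by have [->|_] := eqVneq b j; rewrite ?(negPf jt) ?mulr1 ?addr0 // mulr0 add0r.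
Qed.

Lemma retract_sum (t : seq B) (f : B -> R) :
  p 0 (fun b => \sum_(j <- t) f j * delta j b) = \sum_(j <- t) f j *: p 0 (delta j).
Proof.
elim: t => [|j t IHt].
  by rewrite big_nil -retract0; congr p; apply/funext => b; rewrite big_nil.
rewrite big_cons -IHt -retractZ -retractD scaler0 addr0; congr p.
by apply/funext => b; rewrite big_cons.
Qed.

(** A continuous homomorphism to a discrete module is constant on some member of a Cauchy filter.
    The limit is the image under [p] of these constants, since a neighborhood constrains only
    finitely many coordinates. *)
Lemma retract_complete : complete op.
Proof.
move=> F [FT FI FS F0] cauF.
have evc (N : lmodType R) (h : M -> N) : cont_hom op h -> exists z, F (fun x => h x = z).
  case/cont_homP=> lh /cauF[A FA hA].
  have [x Ax] : exists x, A x.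
    by apply/not_existsP => nA; apply: F0; apply: FS FA _ => x /nA.
  by exists (h x); apply: FS FA _ => y /hA /(_ Ax) /eqP; rewrite is_linearB // subr_eq0 => /eqP.
have [u Fu] := evc _ _ (retract_fst retM).
have [f Ff] := choice (fun b => evc _ _ (retract_snd retM b)).
exists (p u f) => U /nbhd_shift /(retract_cont retM)[s Us].
have Fs : F (fun x => forall b, b \in s -> e x b = f b).
  elim: s {Us} => [|b s IHs]; first exact: FS FT _.
  apply: FS (FI _ _ (Ff b) IHs) _ => x [xb xs] j.
  by rewrite inE => /predU1P[->//|/xs].
apply: FS (FI _ _ Fu Fs) _ => x [xu xs].
rewrite -[x](retractK retM) xu (retractB _ _ f); apply: Us => b /xs ->.
by rewrite subrr.
Qed.

Lemma retract_hausdorff : hausdorff op.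
Proof.
move=> x y neq_xy.
have sep (N : lmodType R) (h : M -> N) : cont_hom op h -> h x <> h y ->
    exists U V, [/\ op U, op V, U x, V y & forall z, U z -> V z -> False].
  move=> [_ oh] hxy; exists (fun z => h z = h x), (fun z => h z = h y).
  split=> // [||z -> //]; first exact: (oh (fun w => w = h x)).
  exact: (oh (fun w => w = h y)).
have [exy|] := pselect (c x = c y); last exact: (sep _ _ (retract_fst retM)).
have [b] : exists b, e x b <> e y b.
  apply: contrapT => /forallNP eqe; apply: neq_xy.
  by rewrite -(retractK retM x) -(retractK retM y) exy; congr p; apply/funext => b; apply: contrapT.
exact: (sep _ _ (retract_snd retM b)).
Qed.

Lemma retract_lattices_base : lattices_base op.
Proof.
move=> U /(retract_cont retM)[s Us].
pose L x := exists2 f, forall b, b \in s -> f b = 0 & x = p 0 f.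
exists L; last by move=> x [f fs ->]; apply: Us.
have subL : is_submod L.
  split; first by exists (fun=> 0); rewrite ?retract0.
    move=> _ _ [f fs ->] [g gs ->]; exists (fun b => f b + g b).
      by move=> b bs; rewrite fs // gs // addr0.
    by rewrite -retractD addr0.
  move=> a _ [f fs ->]; exists (fun b => a * f b).
    by move=> b bs; rewrite fs // mulr0.
  by rewrite -retractZ scaler0.
split=> //.
  (* Where [c x = 0] and [e x] vanishes on [s], the identity [x = p 0 (e x)] puts [x] in [L]. *)
  apply: open_submod => //.
  have [_ nc] := (cont_homP _).1 (retract_fst retM).
  have ne b := ((cont_homP _).1 (retract_snd retM b)).2.
  apply: nbhdS (nbhdI nc (nbhd_all s ne)) => x [cx ex].
  by exists (e x) => //; rewrite -{1}(retractK retM x) cx.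
move=> V subV oV _.
have [t Vt] := retract_cont retM (open_nbhd oV (submod0 subV)).
(* Modulo [V] only coordinates in [t] count, and those in [s] already vanish; the unit vectors at
   the remaining ones generate [L] modulo [V]. *)
pose t' := undup [seq b <- t | b \notin s].
exists (size t'), (fun i => p 0 (delta (tnth (in_tuple t') i))); split=> [i|].
  exists (delta (tnth (in_tuple t') i)) => // b bs; rewrite /delta.
  have: tnth (in_tuple t') i \in t' by apply: mem_tnth.
  rewrite mem_undup mem_filter => /andP[tis _].
  by case: eqP => // ebi; rewrite -ebi bs in tis.
move=> _ [f fs ->]; exists (fun i => f (tnth (in_tuple t') i)).
rewrite -(big_tnth _ _ t' predT (fun j => f j *: p 0 (delta j))) -retract_sum.
rewrite (retractB 0 f (fun b => \sum_(j <- t') f j * delta j b)) addrAC subrr add0r.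
apply: Vt => b bt; rewrite sum_delta ?undup_uniq // mem_undup mem_filter bt andbT.
by case: ifPn => [|/negPn /fs ->]; rewrite subrr.
Qed.

(** Left exactness is formal. To lift [h3], use projectivity on [P]; on the other factor [h3]
    depends on finitely many coordinates, so preimages of its values on unit vectors suffice. *)
Lemma retract_hom_exact : projective P -> hom_exact op.
Proof.
move=> projP N1 N2 N3 f g lf lg injf surjg kerg; split.
- by move=> h h' _ _ eqh x; apply: injf.
- move=> h2 [lh oh]; split=> [gh0|[h1 _ eqh] x]; last first.
    by apply/kerg; exists (h1 x).
  have [h1 eqh] := choice (fun x => (kerg _).1 (gh0 x)).
  exists h1 => //; split=> [a x y|S].
    by apply: injf; rewrite lf -!eqh lh.
  (* By injectivity of [f], the preimage of [S] under [h1] is the preimage under [h2] of the image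
     of [S] under [f]. *)
  have := oh (fun z => exists2 n, S n & z = f n).
  congr op; apply/funext => x; apply/propext; split=> [[n Sn]|Sx]; last by exists (h1 x).
  by rewrite eqh => /injf ->.
- move=> h3 ch3; have [lh nh] := (cont_homP _).1 ch3.
  have [|k [lk gk]] := projP _ _ g (fun u => h3 (p u (fun=> 0))) lg surjg.
    move=> a u v; rewrite -lh -(retract_linear retM); congr (h3 (p _ _)).
    by apply/funext => b; rewrite mulr0 addr0.
  have [s hs] := retract_cont retM nh.
  have [m gm] := choice (fun j => surjg (h3 (p 0 (delta j)))).
  pose t := undup s.
  exists (fun x => k (c x) + \sum_(j <- t) e x j *: m j).
    have [lc nc] := (cont_homP _).1 (retract_fst retM).
    have ne b := ((cont_homP _).1 (retract_snd retM b)).2.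
    apply/cont_homP; split.
      move=> a x y; rewrite lc lk scalerDr addrACA; congr (_ + _).
      rewrite scaler_sumr -big_split /=; apply: eq_bigr => j _.
      have [le _] := retract_snd retM j.
      by rewrite (le a x y) scalerDl scalerA.
    apply: nbhdS (nbhdI nc (nbhd_all t ne)) => x [-> ex].
    by rewrite is_linear0 // add0r big_seq big1 // => j /ex ->; rewrite scale0r.
  move=> x; rewrite is_linearD // gk is_linear_sum // -{1}(retractK retM x).
  rewrite (retractB (c x) (e x) (fun=> 0)) is_linearD //; congr (_ + _).
  rewrite (retractB 0 _ (fun b => \sum_(j <- t) e x j * delta j b)) is_linearD //.
  rewrite [X in _ + X]hs ?addr0; last first.
    by move=> b bs; rewrite sum_delta ?undup_uniq // mem_undup bs subr0 subrr.
  rewrite retract_sum.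
  by rewrite is_linear_sum //; apply: eq_bigr => j _; rewrite !is_linearZ // gm.
Qed.

End RetractTheory.
End TopologicalModule.

(** * Passage between Tate modules and retracts *)

Section TateRetract.
Variables (R : pzRingType) (M : lmodType R) (op : (M -> Prop) -> Prop).
Hypothesis tmodM : is_tmod op.

(* A right-linear map Q -> R is a morphism of left R^c-modules Q -> (R^c)^o. *)
Local Notation Rr := ((R^c)^o : lmodType R^c).

Lemma regular_convD (r : R^c) (a f g : R) :
  r *: (a * f + g : Rr) = (a * (r *: (f : Rr) : R) + (r *: (g : Rr) : R) : R).
Proof. by rewrite -[LHS]/((a * f + g) * (r : R)) mulrDl -mulrA. Qed.

(* A section of the free cover of Q by its own elements gives finite
   coordinates on Q, hence a linear retraction R^Q -> Q^*. *)
Lemma tate_retract : tate op ->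
  exists (P : lmodType R) (B : eqType) (c : M -> P) (e : M -> B -> R) p,
    projective P /\ retract op c e p.
Proof.
move=> [P [Q [projP projQ [i [p [[ri li] ci lp cp pK]]]]]].
have [||s [ls sK]] := projQ _ _ (@free_ext R^c Q Q id) id
    (@free_ext_linear R^c Q Q id).
- by move=> q; exists (free_basis R^c q); apply: free_ext_basis.
- by [].
pose dual (f : Q -> R) : Q -> R := fun q => @free_ext R^c Q Rr f (s q).
have rdual f : rlinear (dual f).
  by move=> a q q'; rewrite /dual ls (free_ext_linear (A := Rr)).
have dualP a f g : dual (fun q => a * f q + g q) = fun q => a * dual f q + dual g q.
  apply/funext => q; rewrite /dual /free_ext mulr_sumr -big_split /=.
  by apply: eq_bigr => b _; apply: regular_convD.
(* Linearity of [i] is only given componentwise; the scalar -1 at the zero vectors forces both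
   components to vanish. *)
have i0 : (i 0).1 = 0 /\ forall q, (i 0).2 q = 0.
  have [l1 l2] := li (-1) 0 0; rewrite scaler0 addr0 in l1 l2.
  by split=> [|q]; [rewrite l1 scaleN1r|rewrite l2 mulN1r]; rewrite addNr.
exists P, Q, (fun x => (i x).1), (fun x => (i x).2), (fun u f => p (u, dual f)).
split=> //; split.
- apply/cont_homP => //; split=> [a x y|]; first by case: (li a x y).
  have [U [oU U0] iU] := ci 0 [::].
  by exists U; split=> // y /iU[-> _]; case: i0.
- move=> b; apply/cont_homP => //; split=> [a x y|]; first by case: (li a x y).
  have [U [oU U0] iU] := ci 0 [:: b].
  by exists U; split=> // y /iU[_ ->]; rewrite ?mem_head //; case: i0.
- by move=> a u v f g; rewrite dualP -lp //; apply: rdual.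
- move=> U [W [oW W0 WU]].
  have p0 : p (0, fun=> 0) = 0.
    have rl0 : rlinear (fun _ : Q => 0 : R) by move=> a q q'; rewrite mul0r addr0.
    have := lp (-1) (0, fun=> 0) (0, fun=> 0) rl0 rl0.
    rewrite /= scaler0 addr0 scaleN1r addNr => p0; rewrite -[RHS]p0; congr (p (_, _)).
    by apply/funext => q; rewrite mulr0 addr0.
  rewrite -p0 in W0.
  have [|qs Wqs] := cp (0, fun=> 0) W _ oW W0.
    by move=> a q q'; rewrite mul0r addr0.
  (* The value of [dual f] at [q] involves only the coordinates of [f] in the finite support of
     [s q]. *)
  exists (flatten [seq msupp (s q) : seq Q | q <- qs]) => f fs; apply/WU/Wqs => //=.
  move=> q qqs; rewrite /dual /free_ext big_seq big1 // => b bs.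
  rewrite fs ?scaler0 //; apply/flattenP; exists (msupp (s q) : seq Q) => //.
  exact: map_f.
- move=> x; rewrite -[RHS](pK x) [in RHS](surjective_pairing (i x)); congr (p (_, _)).
  apply/funext => q; rewrite -[in RHS](sK q) /dual /free_ext.
  rewrite (is_linear_sum (B := Rr) (ri x)); apply: eq_bigr => b _.
  by rewrite (is_linearZ (B := Rr) (ri x)).
Qed.

(** The dual of the free right module on [B] is R^B: [dual] extends a function from the basis, and
    evaluation on the basis restricts it back. Finite supports make pointwise convergence on the
    module equivalent to convergence on [B]. *)
Lemma retract_summand (P : lmodType R) (B : choiceType)
    (c : M -> P) (e : M -> B -> R) p :
  retract op c e p -> summand_of op P (free_mod R^c B).
Proof.
move=> retM; pose dual (f : B -> R) : free_mod R^c B -> R := @free_ext R^c B Rr f.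
have rdual f : rlinear (dual f) by move=> a q q'; rewrite /dual (free_ext_linear (A := Rr)).
have dualB f b : dual f (free_basis _ b) = f b by exact: (free_ext_basis (A := Rr)).
exists (fun x => (c x, dual (e x))), (fun u => p u.1 (fun b => u.2 (free_basis _ b))).
have [lc nc] := (cont_homP tmodM _).1 (retract_fst retM).
have ne b := (cont_homP tmodM _).1 (retract_snd retM b).
split.
- split=> [x|a x y /=]; first exact: rdual.
  split=> // q; rewrite /dual /free_ext mulr_sumr -big_split /=.
  apply: eq_bigr => b _; have [le _] := ne b.
  by rewrite (le a x y); apply: regular_convD.
- move=> x qs; pose bs := flatten [seq msupp q : seq B | q <- qs].
  have nbs : nbhd op x (fun y => c y = c x /\ forall b, b \in bs -> e y b = e x b).
    apply/nbhd_shift => //.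
    have neb b := (ne b).2.
    apply: nbhdS (nbhdI tmodM nc (nbhd_all tmodM bs neb)) => y [cy ey].
    split=> [|b /ey eb]; first by rewrite is_linearD // cy addr0.
    by have [le _] := ne b; rewrite (is_linearD le) eb addr0.
  have [U [oU Ux Ubs]] := nbs; exists U => // y /Ubs[cy ey]; split=> // q qqs /=.
  rewrite /dual /free_ext; apply: eq_big_seq => b bq; rewrite ey //.
  by apply/flattenP; exists (msupp q : seq B) => //; apply: map_f.
- by move=> a u v _ _; rewrite -(retract_linear retM).
- move=> u W _ oW Wu.
  have := (nbhd_shift tmodM _ _).1 (open_nbhd oW Wu).
  move=> /(retract_cont retM)[s Ws].
  exists [seq free_basis _ b | b <- s] => v _ -> eqs.
  rewrite (retractB retM _ _ (fun b => u.2 (free_basis _ b))); apply: Ws => b bs.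
  by rewrite eqs ?subrr //; apply: map_f.
- by move=> x /=; rewrite -[RHS](retractK retM x); congr p; apply/funext.
Qed.

End TateRetract.

(** * The converse *)

Section Converse.
Variables (R : pzRingType) (M : lmodType R) (op : (M -> Prop) -> Prop).
Hypotheses (tmodM : is_tmod op) (exM : hom_exact op).

Definition cont_end (t : M -> M) :=
  is_linear t /\ forall U, nbhd op 0 U -> nbhd op 0 (fun x => U (t x)).

(* A triple (r, g, k) encodes the map x |-> sum_(i < r) k x i *: g i. *)
Definition finite_rank_map (d : nat * (nat -> M) * (M -> nat -> R)) (x : M) : M :=
  \sum_(i < d.1.1) d.2 x i *: d.1.2 i.

(** Coefficients of [t x] over generators of L/L' are chosen pointwise, hence linear and continuous
    only modulo the vectors that [phi] sends into [L']; [hom_exact_lift] replaces them by a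
    continuous homomorphism. *)
Lemma lattice_step (L L' : M -> Prop) (t : M -> M) :
  lattice op L -> lattice op L' -> (forall x, L' x -> L x) ->
  cont_end t -> (forall x, L (t x)) ->
  exists d : nat * (nat -> M) * (M -> nat -> R),
    [/\ forall i, L (d.1.2 i), forall i, cont_hom op (fun x => d.2 x i : R^o)
      & forall x, L' (t x - finite_rank_map d x)].
Proof.
move=> [subL _ fgL] [subL' oL' _] L'L [lt ct] Lt.
have [n [g [Lg genL]]] := fgL L' subL' oL' L'L.
pose phi (v : 'rV[R]_n) := \sum_(i < n) v 0 i *: g i.
have lphi : is_linear phi.
  move=> a v w; rewrite /phi scaler_sumr -big_split /=.
  by apply: eq_bigr => i _; rewrite !mxE scalerDl scalerA.
have /choice[h th] : forall x, exists v, L' (t x - phi v).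
  move=> x; have [v Lv] := genL _ (Lt x); exists (\row_i v i).
  by move: Lv; congr (L' (_ - _)); apply: eq_bigr => i _; rewrite mxE.
have [|||k ck kh] := hom_exact_lift tmodM (K := fun v => L' (phi v)) (h := h) exM.
- split=> [|v w Lv Lw|a v Lv]; first by rewrite is_linear0 //; apply: submod0.
    by rewrite is_linearD //; apply: submodD.
  by rewrite is_linearZ //; apply: submodZ.
- move=> a x y; rewrite is_linearB // lphi.
  apply: (submod_trans subL' (y := t (a *: x + y))); first exact: submodBC (th _).
  rewrite lt opprD addrACA -scalerBr.
  by apply: submodD => //; apply: submodZ.
- apply: nbhdS (ct _ (open_nbhd oL' (submod0 subL'))) => x Ltx.
  by rewrite -[phi _](subKr (t x)); apply: submodB.
(* Padding by 0 beyond [n] gives data whose type does not depend on [n], as the later recursion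
   requires. *)
exists (n, fun j => odflt 0 (omap g (insub j)),
        fun x j => odflt 0 (omap (k x 0) (insub j))); split=> [j|j|x] /=.
- by case: insubP => [i _ _|_] /=; [apply: Lg|apply: submod0].
- have [lk nk] := (cont_homP tmodM _).1 ck.
  apply/cont_homP => //; split=> [a x y|].
    by case: insubP => [i _ _|_] /=; rewrite ?lk ?mxE // scaler0 addr0.
  by apply: nbhdS nk => x ->; case: insubP => [i _ _|_] //=; rewrite mxE.
- rewrite /finite_rank_map /=; under eq_bigr => i _ do rewrite valK /=.
  apply: (submod_trans subL' (y := phi (h x))) => //.
  by rewrite -is_linearB //; have := submodN subL' (kh x); rewrite -is_linearN ?opprB.
Qed.

Lemma finite_rank_map_cont_end d :
  (forall i, cont_hom op (fun x => d.2 x i : R^o)) -> cont_end (finite_rank_map d).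
Proof.
move=> cd; split=> [a x y|U nU].
  rewrite /finite_rank_map scaler_sumr -big_split /=; apply: eq_bigr => i _.
  by have [ld _] := cd i; rewrite (ld a x y) scalerDl scalerA.
have nd i := ((cont_homP tmodM _).1 (cd i)).2.
apply: nbhdS (nbhd_all tmodM (iota 0 d.1.1) nd) => x dx.
rewrite /finite_rank_map big1 => [|i _]; last by rewrite dx ?scale0r // mem_iota ltn_ord.
by case: nU => V [_ V0]; apply.
Qed.

Lemma cont_endB t t' : cont_end t -> cont_end t' -> cont_end (fun x => t x - t' x).
Proof.
move=> [lt ct] [lt' ct']; split=> [a x y|U].
  by rewrite lt lt' scalerBr opprD addrACA.
have [_ opD opN _] := tmodM.
move=> [U' [oU U'0 U'U]].
have U'00 : U' (0 + 0) by rewrite addr0.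
have [V [W [oV V0 oW W0 VW]]] := opD _ _ _ oU U'00.
have W0N : W (- 0) by rewrite oppr0.
have [W' [oW' W'0] NW] := opN _ _ oW W0N.
apply: nbhdS (nbhdI tmodM (ct _ (open_nbhd oV V0)) (ct' _ (open_nbhd oW' W'0))).
by move=> x [Vx Wx]; apply/U'U/VW => //; apply: NW.
Qed.

Lemma lattice_chain : countable_base_at0 op -> lattices_base op ->
  exists L : nat -> M -> Prop,
    [/\ forall n, lattice op (L n), forall n x, L n.+1 x -> L n x
      & forall U, nbhd op 0 U -> exists n, forall x, L n x -> U x].
Proof.
move=> [B [nB Bbase]] latM.
have [lat latP] : exists lat : (M -> Prop) -> M -> Prop, forall U, nbhd op 0 U ->
    lattice op (lat U) /\ forall x, lat U x -> U x.
  have /choice[lat latP] : forall U, exists L, nbhd op 0 U ->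
      lattice op L /\ forall x, L x -> U x.
    move=> U; have [/latM[L lL LU]|nU] := pselect (nbhd op 0 U); first by exists L.
    by exists (fun=> True).
  by exists lat.
(* Each lattice is chosen inside both the next basic neighborhood and the previous lattice, so the
   chain decreases and remains a base. *)
pose fix L n := lat (if n is m.+1 then fun x => B n x /\ L m x else B 0%N).
have nlat N : lattice op N -> nbhd op 0 N.
  by case=> subN oN _; apply: open_nbhd oN (submod0 subN).
have LP n : lattice op (L n).
  elim: n => [|n IHn]; first by case: (latP _ (nB 0%N)).
  by case: (latP _ (nbhdI tmodM (nB n.+1) (nlat _ IHn))).
have LS n x : L n.+1 x -> B n.+1 x /\ L n x.
  by case: (latP _ (nbhdI tmodM (nB n.+1) (nlat _ (LP n)))) => _; apply.
exists L; split=> // [n x /LS[]//|U /Bbase[n BU]]; exists n => x Lx; apply: BU.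
by case: n Lx => [|n] Lx; [case: (latP _ (nB 0%N)) => _; apply|case: (LS _ _ Lx)].
Qed.

(** The sets containing a tail of [s] form a Cauchy filter. Its limit is congruent to a late term
    modulo the open [L n], and that term to [s n]. *)
Lemma complete_chain (L : nat -> M -> Prop) (s : nat -> M) :
  complete op -> (forall n, is_submod (L n) /\ op (L n)) ->
  (forall n x, L n.+1 x -> L n x) ->
  (forall U, nbhd op 0 U -> exists n, forall x, L n x -> U x) ->
  (forall n, L n (s n.+1 - s n)) ->
  exists l, forall n, L n (l - s n).
Proof.
move=> complM LP LS Lbase Ls.
have Lle m n x : (m <= n)%N -> L n x -> L m x.
  by move=> /subnK <-; elim: (n - m)%N => //= k IHk /LS.
have Lsle m n : (m <= n)%N -> L m (s n - s m).
  move=> /subnK <-; elim: (n - m)%N => [|k IHk].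
    by rewrite subrr; apply: submod0; case: (LP m).
  apply: (submod_trans (LP m).1 _ IHk).
  by apply: Lle (Ls (k + m)%N); rewrite leq_addl.
have [|U /Lbase[n LU]|l lP] := complM (fun A => exists N, forall n, (N <= n)%N -> A (s n)).
- split; first by exists 0%N.
  + move=> A A' [N AN] [N' AN']; exists (maxn N N') => n.
    by rewrite geq_max => /andP[/AN ? /AN'].
  + by move=> A A' [N AN] AA'; exists N => n /AN /AA'.
  + by move=> [N /(_ N (leqnn N))].
- exists (fun x => L n (x - s n)); first by exists n => m; apply: Lsle.
  move=> x y Lx Ly; apply: LU; apply: (submod_trans (LP n).1 Lx).
  by apply: submodBC Ly; case: (LP n).
exists l => n; have [subL oL] := LP n.
have [|N lN] := lP (fun x => L n (x - l)).
  apply/nbhd_shift => //; apply: nbhdS (open_nbhd oL (submod0 subL)) => y.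
  by rewrite addrAC subrr add0r.
have := lN (maxn N n) (leq_maxl _ _) => /(submodBC subL) /(submod_trans subL); apply.
exact/Lsle/leq_maxr.
Qed.

Lemma tate_of_chain (L : nat -> M -> Prop) :
  complete op -> hausdorff op ->
  (forall n, lattice op (L n)) -> (forall n x, L n.+1 x -> L n x) ->
  (forall U, nbhd op 0 U -> exists n, forall x, L n x -> U x) ->
  tate op.
Proof.
move=> complM hausM latL LS Lbase.
have subL n : is_submod (L n) by case: (latL n).
have oL n : op (L n) by case: (latL n).
have L_eq0 z : (forall n, L n z) -> z = 0.
  move=> Lz; apply: contrapT => /hausM[U [V [_ oV Uz V0 UV]]].
  have [n LV] := Lbase _ (open_nbhd oV V0).
  exact: UV Uz (LV _ (Lz n)).
pose P := free_mod R M; pose pi := @free_ext R M M id.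
have lpi : is_linear pi by apply: free_ext_linear.
(* [free_basis] is not linear, but [pi] maps [free_basis x] to [x], so it is linear and continuous
   modulo the preimage of [L 0%N]. *)
have [|||c cc Lc] := hom_exact_lift tmodM (K := fun u : P => L 0%N (pi u))
    (h := @free_basis R M) exM.
- split=> [|u v Lu Lv|a u Lu]; first by rewrite is_linear0 //; apply: submod0.
    by rewrite is_linearD //; apply: submodD.
  by rewrite is_linearZ //; apply: submodZ.
- move=> a x y; rewrite is_linearB // lpi /pi !free_ext_basis subrr.
  exact: submod0.
- apply: nbhdS (open_nbhd (oL 0%N) (submod0 (subL 0%N))) => x.
  by rewrite /pi free_ext_basis.
pose good n t := cont_end t /\ forall x, L n (t x).
(* A choice is made for every pair, even where [good] fails, so that [t] can be defined by recursion
   before [goodt] is proved. *)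
have /choice[step stepP] : forall nt : nat * (M -> M),
    exists d : nat * (nat -> M) * (M -> nat -> R), good nt.1 nt.2 ->
    [/\ forall i, L nt.1 (d.1.2 i), forall i, cont_hom op (fun x => d.2 x i : R^o)
      & forall x, L nt.1.+1 (nt.2 x - finite_rank_map d x)].
  move=> [n t].
  have [[ct Lt]|ngood] := pselect (good n t); last by exists (0%N, fun=> 0, fun _ _ => 0).
  by have [d dP] := lattice_step (latL n) (latL n.+1) (LS n) ct Lt; exists d.
pose fix t n : M -> M :=
  if n is m.+1 then fun x => t m x - finite_rank_map (step (m, t m)) x else fun x => x - pi (c x).
have goodt n : good n (t n).
  elim: n => [|n IHn].
    split=> [|x]; last first.
      by apply: submodBC => //; have := Lc x; rewrite is_linearB // /pi free_ext_basis.
    apply: (cont_endB (t := id)) => //.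
    have [lc nc] := (cont_homP tmodM _).1 cc.
    split=> [a x y|U nU]; first by rewrite lc lpi.
    apply: nbhdS nc => x ->; rewrite is_linear0 //.
    by case: nU => V [_ V0]; apply.
  have [Lg ck Lt] := stepP (n, t n) IHn; split=> //.
  by apply: cont_endB; [case: IHn|apply: finite_rank_map_cont_end].
pose d n := step (n, t n).
have dP n := stepP (n, t n) (goodt n).
pose S n (u : P) (f : nat * nat -> R) : M :=
  pi u + \sum_(m < n) \sum_(i < (d m).1.1) f (m : nat, i : nat) *: (d m).1.2 i.
pose e x (b : nat * nat) := (d b.1).2 x b.2.
have St n x : x - S n (c x) (e x) = t n x.
  elim: n => [|n IHn] /=; first by rewrite /S big_ord0 addr0.
  by rewrite -IHn /S big_ord_recr /= addrA opprD addrA.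
have SL n a u v f g :
    S n (a *: u + v) (fun b => a * f b + g b) = a *: S n u f + S n v g.
  rewrite /S lpi scalerDr addrACA; congr (_ + _).
  rewrite scaler_sumr -big_split; apply: eq_bigr => m _ /=.
  rewrite scaler_sumr -big_split; apply: eq_bigr => i _ /=.
  by rewrite scalerDl scalerA.
(* The partial sums converge because the increment from [S n] to [S n.+1] combines generators lying
   in [L n]. *)
have /choice[q qP] : forall uf : P * (nat * nat -> R), exists l, forall n, L n (l - S n uf.1 uf.2).
  move=> [u f]; apply: (complete_chain (s := fun n => S n u f)) => // n /=.
  rewrite /S big_ord_recr /= addrA [X in L n X]addrAC subrr add0r.
  by apply: submod_sum => // i _; apply: submodZ => //; case: (dP n) => /(_ i).
pose p u f := q (u, f).
exists P, (free_mod R^c (nat * nat)%type); split; [exact: free_mod_projective..|].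
apply: (retract_summand tmodM (c := c) (e := e) (p := p)); split=> //.
- by move=> [m i]; have [_ ck _] := dP m; apply: ck.
(* Partial sums are linear, so both sides are congruent modulo every [L n]; separation makes them
   equal. *)
- move=> a u v f g; apply/eqP; rewrite -subr_eq0; apply/eqP/L_eq0 => n.
  apply: (submod_trans (subL n) (qP (_, _) n)); rewrite /= SL.
  apply: submodBC => //; rewrite opprD addrACA -scalerBr.
  apply: submodD => //; last exact: (qP (v, g) n).
  by apply: submodZ => //; apply: (qP (u, f) n).
- move=> U /Lbase[n LU].
  (* These are exactly the coordinates entering [S n]; if [f] vanishes on them, then [p 0 f] is in
     [L n]. *)
  exists [seq (m, i) | m <- iota 0 n, i <- iota 0 (d m).1.1] => f fs; apply: LU.
  have := qP (0, f) n; rewrite /= /S is_linear0 // add0r big1 ?subr0 // => m _.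
  rewrite big1 // => i _; rewrite fs ?scale0r //.
  by apply/allpairsPdep; exists (m : nat), (i : nat); rewrite !mem_iota !ltn_ord.
- move=> x; apply/eqP; rewrite -subr_eq0; apply/eqP/L_eq0 => n.
  apply: (submod_trans (subL n) (qP (_, _) n)) => /=.
  by apply: submodBC => //; rewrite St; case: (goodt n).
Qed.

End Converse.

Theorem theorem3p2 (R : pzRingType) (M : lmodType R)
  (op : (M -> Prop) -> Prop) (Htm : is_tmod op) :
  (tate op ->
     [/\ complete op /\ hausdorff op, lattices_base op & hom_exact op]) /\
  (countable_base_at0 op ->
     complete op -> hausdorff op -> lattices_base op -> hom_exact op ->
     tate op).
Proof.
split=> [/(tate_retract Htm)[P [B [c [e [p [projP retM]]]]]]|cb complM hausM latM exM].
  split; last exact: retract_hom_exact retM projP.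
    by split; [apply: retract_complete retM|apply: retract_hausdorff retM].
  exact: retract_lattices_base retM.
have [L [latL LS Lbase]] := lattice_chain Htm cb latM.
exact: tate_of_chain latL LS Lbase.
Qed.
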